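(* Let $A$ be a nonempty finite subset of a Hadamard space $(X,d)$. Then the mean set $\mathrm{mean}(A)$ is a nonempty, compact, path-connected subset of the closed convex hull of $A$, and it coincides with the set of strongly $A$-minimal points and with the set of $A$-Pareto points. In particular, $\mathrm{mean}(A) = \mathrm{minimal}(A) \subset \mathrm{cl}\,\mathrm{conv}(A)$.
   Context: A Hadamard space is a complete CAT(0) geodesic space. A set in it is convex if it contains the geodesic segment between any two of its points; $\mathrm{conv}(A)$ is the intersection of all convex sets containing $A$, and the closed convex hull is $\mathrm{cl}\,\mathrm{conv}(A)$, the closure of $\mathrm{conv}(A)$. Let $\Delta^A = \{ w \in \mathbb{R}^A : w_a \ge 0 \ \forall a\in A,\ \sum_{a \in A} w_a = 1\}$. The mean set $\mathrm{mean}(A)$ is the set of points $\bar x \in X$ for which there exists $w \in \Delta^A$ such that $\bar x$ minimizes $x \mapsto \sum_{a\in A} w_a d(a,x)^2$ over $X$. A point $\bar x \in X$ is: strongly $A$-minimal if no point $x \ne \bar x$ satisfies $d(a,x) \le d(a,\bar x)$ for all $a \in A$; $A$-Pareto if every $x \in X$ with $d(a,x) \le d(a,\bar x)$ for all $a\in A$ satisfies $d(a,x) = d(a,\bar x)$ for all $a \in A$; $A$-minimal if no $x \in X$ satisfies $d(a,x) < d(a,\bar x)$ for all $a \in A$. $\mathrm{minimal}(A)$ is the set of $A$-minimal points. *)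

(* Defs.v *)
From mathcomp Require Import all_boot all_order all_algebra finmap.
From mathcomp Require Import all_classical all_reals topology normedtype.

Set Implicit Arguments.
Unset Strict Implicit.
Unset Printing Implicit Defensive.
Import Order.TTheory GRing.Theory Num.Theory.
Import numFieldNormedType.Exports.
Local Open Scope classical_set_scope.
Local Open Scope ring_scope.

(* The Euclidean distance of the comparison plane; the library's product balls
   on R * R are those of the sup distance. *)
Definition eucl_dist (R : realType) (u v : R * R) : R :=
  Num.sqrt ((u.1 - v.1) ^+ 2 + (u.2 - v.2) ^+ 2).

Section Hadamard.
Context {R : realType} {X : metricType R}.
Implicit Types (x y z p q r : X) (S C : set X).

(* A geodesic is parametrized by arc length on [0, d(x, y)]; its values outside
   this interval are irrelevant. *)
Definition geodesic x y (g : R -> X) : Prop :=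
  [/\ g 0 = x, g (mdist x y) = y &
      {in `[0, mdist x y] &, forall s t, mdist (g s) (g t) = `|s - t|}].

Definition geodesic_segment x y S : Prop :=
  exists2 g : R -> X, geodesic x y g & S = g @` `[0, mdist x y]%classic.

(* z' is the point of the Euclidean segment [x', y'] that corresponds to z in
   the side S with endpoints x and y. When d(x, y) = |x' - y'|, the two
   equalities force z' to lie on [x', y'], since their right-hand sides add up
   to |x' - y'|. *)
Definition comparison_point x y S (x' y' : R * R) z (z' : R * R) : Prop :=
  [/\ S z, eucl_dist x' z' = mdist x z & eucl_dist z' y' = mdist z y].

Definition cat0_triangle p q r (Spq Sqr Srp : set X) : Prop :=
  forall p' q' r' : R * R,
    eucl_dist p' q' = mdist p q -> eucl_dist q' r' = mdist q r ->
    eucl_dist r' p' = mdist r p ->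
  let comparison z (z' : R * R) :=
    [\/ comparison_point p q Spq p' q' z z',
        comparison_point q r Sqr q' r' z z' |
        comparison_point r p Srp r' p' z z'] in
  forall x y (x' y' : R * R), comparison x x' -> comparison y y' ->
    mdist x y <= eucl_dist x' y'.

Definition gconvex C : Prop :=
  forall x y S, C x -> C y -> geodesic_segment x y S -> S `<=` C.

Definition conv_hull (B : set X) : set X := smallest gconvex B.

Definition path_connected (B : set X) : Prop :=
  forall x y, B x -> B y -> exists g : R -> X,
    [/\ {within `[0, 1]%classic, continuous g}, g 0 = x, g 1 = y &
        g @` `[0, 1]%classic `<=` B].

End Hadamard.

Definition geodesic_space (R : realType) (X : metricType R) : Prop :=
  forall x y : X, exists g, geodesic x y g.

Definition cat0 (R : realType) (X : metricType R) : Prop :=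
  forall (p q r : X) (Spq Sqr Srp : set X),
    geodesic_segment p q Spq -> geodesic_segment q r Sqr ->
    geodesic_segment r p Srp -> cat0_triangle p q r Spq Sqr Srp.

(* The axiom of completeType, which cannot be used as such here because it
   carries a distinguished point. *)
Definition complete_space (R : realType) (X : metricType R) : Prop :=
  forall F : set_system X, ProperFilter F -> cauchy F -> exists x : X, F --> x.

Definition hadamard_space (R : realType) (X : metricType R) : Prop :=
  [/\ complete_space X, geodesic_space X & cat0 X].

Section Minimality.
Context {R : realType} {X : metricType R}.
Variable A : {fset X}.

Definition simplex : set (A -> R) :=
  [set w | (forall a, 0 <= w a) /\ \sum_(a : A) w a = 1].

Definition mean_set : set X :=
  [set xbar | exists2 w, simplex w & forall x : X,
     \sum_(a : A) w a * mdist (val a) xbar ^+ 2 <=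
     \sum_(a : A) w a * mdist (val a) x ^+ 2].

Definition strongly_minimal_set : set X :=
  [set xbar | ~ exists2 x : X, x <> xbar &
     forall a, a \in A -> mdist a x <= mdist a xbar].

Definition pareto_set : set X :=
  [set xbar | forall x : X,
     (forall a, a \in A -> mdist a x <= mdist a xbar) ->
     forall a, a \in A -> mdist a x = mdist a xbar].

Definition minimal_set : set X :=
  [set xbar | ~ exists x : X, forall a, a \in A -> mdist a x < mdist a xbar].

End Minimality.

(* Main.v *)
(* Squared distances are strongly convex along geodesics of a CAT(0) space, so
   a weighted sum of the squared distances to A has a unique minimizer, which
   is a Lipschitz function of the weights: mean(A) is a continuous image of the
   simplex. Passing to a midpoint shows that minimal points are strongly
   minimal. The inclusion of the strongly minimal points in mean(A), a minimax
   statement, is obtained without separating convex sets: the weights are found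
   by maximising a concave dual function over the compact simplex. *)

Require Import Defs.
From mathcomp Require Import all_boot all_order all_algebra finmap.
From mathcomp Require Import all_classical all_reals topology normedtype.
From mathcomp Require Import derive ring lra.

Set Implicit Arguments.
Unset Strict Implicit.
Unset Printing Implicit Defensive.
Import Order.TTheory GRing.Theory Num.Theory.
Import numFieldNormedType.Exports.
Local Open Scope classical_set_scope.
Local Open Scope ring_scope.

(** * Squared distances in CAT(0) spaces; minimization of strongly convex functions *)

Section CAT0.
Context {R : realType} {X : metricType R}.
Implicit Types (x y z p : X) (t : R).

(** In the comparison plane [x] is placed at the origin, [y] at [(c, 0)] and [p] at [(u, h)]; the
    right-hand side is then the squared Euclidean distance from [(u, h)] to [(t * c, 0)]. *)
Lemma cat0_comparison p x y (g : R -> X) t : cat0 X -> geodesic_space X ->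
  geodesic x y g -> 0 <= t <= 1 ->
  mdist p (g (t * mdist x y)) ^+ 2 <=
    (1 - t) * mdist p x ^+ 2 + t * mdist p y ^+ 2
    - t * (1 - t) * mdist x y ^+ 2.
Proof.
move=> catX geoX gg /andP[t0 t1].
have [g0 g1 gd] := gg.
set c := mdist x y; set b := mdist p x; set a := mdist p y.
have c_ge0 : 0 <= c := mdist_ge0 _ _.
have b_ge0 : 0 <= b := mdist_ge0 _ _.
have a_ge0 : 0 <= a := mdist_ge0 _ _.
have [c0|c_neq0] := eqVneq c 0.
  have xy : x = y by exact: mdist_positivity c0.
  rewrite c0 mulr0 g0 /a -xy -/b; lra.
have c_gt0 : 0 < c by rewrite lt_neqAle eq_sym c_neq0.
have ab : c <= b + a by rewrite /b metric_sym; exact: metric_triangle.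
have bc : a <= b + c by exact: metric_triangle.
have ac : b <= a + c by rewrite /c metric_sym; exact: metric_triangle.
(* By the law of cosines [u] is the first coordinate of the apex; the triangle inequalities bound it
   by [b] in absolute value, so that the height [h] exists. *)
pose u := (b ^+ 2 + c ^+ 2 - a ^+ 2) / (2 * c).
have uc : 2 * c * u = b ^+ 2 + c ^+ 2 - a ^+ 2 by rewrite /u; field.
have u2 : u ^+ 2 <= b ^+ 2.
  have ub : u <= b by nra.
  have bu : - b <= u by nra.
  by rewrite -subr_ge0 subr_sqr mulr_ge0// ?subr_ge0// -lerBlDl add0r.
pose h := Num.sqrt (b ^+ 2 - u ^+ 2).
have hE : h ^+ 2 = b ^+ 2 - u ^+ 2 by rewrite sqr_sqrtr// subr_ge0.
have sqrtE (s r : R) : 0 <= r -> s = r ^+ 2 -> Num.sqrt s = r.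
  by move=> r0 ->; rewrite sqrtr_sqr ger0_norm.
have [gyp gypP] := geoX y p; have [gpx gpxP] := geoX p x.
have tc_itv : t * c \in `[0, c] by rewrite in_itv/=; apply/andP; split; nra.
have itv0 : 0 \in `[0, c] by rewrite in_itv/= lexx.
have itvc : c \in `[0, c] by rewrite in_itv/= lexx c_ge0.
have := catX x y p _ _ _ (ex_intro2 _ _ _ gg erefl)
  (ex_intro2 _ _ _ gypP erefl) (ex_intro2 _ _ _ gpxP erefl)
  (0, 0) (c, 0) (u, h).
have dxy : eucl_dist (0, 0) (c, 0) = c by apply: sqrtE => //=; ring.
have dyp : eucl_dist (c, 0) (u, h) = mdist y p.
  by rewrite metric_sym -/a; apply: sqrtE => //=; move: hE uc; lra.
have dpx : eucl_dist (u, h) (0, 0) = b by apply: sqrtE => //=; move: hE uc; lra.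
move=> /(_ dxy dyp dpx p (g (t * c)) (u, h) (t * c, 0)).
have SE : (1 - t) * b ^+ 2 + t * a ^+ 2 - t * (1 - t) * c ^+ 2 =
    (u - t * c) ^+ 2 + h ^+ 2.
  by have := congr1 ( *%R t) uc; move: hE; lra.
have -> : eucl_dist (u, h) (t * c, 0) =
    Num.sqrt ((1 - t) * b ^+ 2 + t * a ^+ 2 - t * (1 - t) * c ^+ 2).
  by rewrite SE /eucl_dist /= subr0.
move=> H; have {H} := H _ _.
have S0 : 0 <= (1 - t) * b ^+ 2 + t * a ^+ 2 - t * (1 - t) * c ^+ 2.
  by rewrite SE addr_ge0// sqr_ge0.
rewrite -(ler_pXn2r (n := 2)) ?nnegrE ?mdist_ge0 ?sqrtr_ge0// sqr_sqrtr//.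
apply.
(* The apex [p] is compared as the endpoint, at parameter 0, of the side from [p] to [x]. *)
- apply: Or33; split; rewrite ?dpx ?mdistxx//.
    exists 0; last by case: gpxP.
    by rewrite /= in_itv/= lexx mdist_ge0.
  by apply: sqrtE => //=; ring.
- apply: Or31; split.
  + by exists (t * c).
  + rewrite -{1}g0 gd//; apply: sqrtE => //=.
    by rewrite real_normK ?num_real//; ring.
  + rewrite -{1}g1 gd// -/c; apply: sqrtE => //=.
    by rewrite real_normK ?num_real//; ring.
Qed.

(** The same [m] serves every [p], so the inequality can be summed with weights. *)
Lemma cat0_midpoint x y : cat0 X -> geodesic_space X ->
  exists m, forall p, mdist p m ^+ 2 <=
    (mdist p x ^+ 2 + mdist p y ^+ 2) / 2 - mdist x y ^+ 2 / 4.
Proof.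
move=> catX geoX; have [g gg] := geoX x y.
exists (g (2^-1 * mdist x y)) => p.
have := cat0_comparison (t := 2^-1) p catX geoX gg _.
move=> /(_ _)/le_trans; apply; last by lra.
by apply/andP; split; lra.
Qed.

Lemma ler_dist_mdist p x y : `|mdist p x - mdist p y| <= mdist x y.
Proof.
have := metric_triangle p x y; have := metric_triangle p y x.
rewrite (metric_sym y x) ler_norml => *; apply/andP; split; lra.
Qed.

Lemma mdist_continuous p : continuous (mdist p : X -> R).
Proof.
move=> x; apply/cvgrPdist_lt => e e0.
apply: filterS (nbhsx_ballx x e e0) => y; rewrite ballEmdist/=.
exact/le_lt_trans/ler_dist_mdist.
Qed.

(* The sublevel sets of [f] just above its infimum form a Cauchy filter. *)
Lemma strongly_convex_minimizer (f : X -> R) (x0 : X) : complete_space X ->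
  continuous f -> (forall x, 0 <= f x) ->
  (forall x y, exists m, f m <= (f x + f y) / 2 - mdist x y ^+ 2 / 4) ->
  exists m, forall x, f m <= f x.
Proof.
move=> cX cf f0 fconv.
pose i := inf (range f).
have hinf : has_inf (range f).
  by split; [exists (f x0), x0|exists 0 => _ [x _ <-]].
have i_le x : i <= f x by apply: (ge_inf (proj2 hinf)); exists x.
pose B e := [set x | f x < i + e].
pose F := filter_from [set e : R | 0 < e] B.
have FF : ProperFilter F.
  apply: filter_from_proper.
    apply: filter_from_filter; first by exists 1 => /=.
    move=> d e /= d0 e0; exists (Num.min d e); first by rewrite lt_min d0.
    move=> x; rewrite /B/= -ltrBlDl lt_min => /andP[].
    by rewrite !ltrBlDl.
  move=> e e0; have [_ [x _ <-] xe] := inf_adherent e0 hinf.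
  by exists x.
have cF : cauchy F.
  apply: cauchy_exP => e e0.
  (* If [f x] and [f y] are below [i + e ^+ 2 / 4], the convexity bound and [i <= f m] give
     [mdist x y < e]. *)
  have e4 : 0 < e ^+ 2 / 4 by rewrite divr_gt0// exprn_gt0.
  have [_ [x _ <-] xe] := inf_adherent e4 hinf.
  exists x, (e ^+ 2 / 4) => // y; rewrite /B/= => ye.
  rewrite ballEmdist/= -(ltr_pXn2r (n := 2)) ?nnegrE ?mdist_ge0 ?ltW//.
  have [m fm] := fconv x y; have := i_le m; rewrite -/i in xe; lra.
have [m Fm] := cX F FF cF; exists m => x.
apply: le_trans (i_le x); apply/ler_addgt0Pr => e e0.
have fF : f @ F --> f m by apply: cvg_trans (cf m); exact: cvg_app.
apply: (closed_cvg (fun s => s <= i + e)) fF; first exact: closed_le.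
by exists e => // y /ltW.
Qed.

End CAT0.

Lemma cvg_sumr (R : realType) (I : finType) (T : Type) (F : set_system T)
    (f : I -> T -> R) (l : I -> R) {FF : Filter F} :
  (forall i, f i x @[x --> F] --> l i) ->
  \sum_i f i x @[x --> F] --> \sum_i l i.
Proof.
move=> fl; apply: cvg_big => [|i _]; last exact: fl.
exact: add_continuous.
Qed.

(** * Weighted sums of squared distances: existence, uniqueness and stability of minimizers *)

Section WeightedMeans.
Context {R : realType} {X : metricType R} {A : {fset X}}.
Implicit Types (w v : A -> R) (x y : X) (t : R).

Definition wsq w x := \sum_(a : A) w a * mdist (val a) x ^+ 2.

Definition minimizes w x := forall y, wsq w x <= wsq w y.

Lemma simplex_segment w v t : simplex w -> simplex v -> 0 <= t <= 1 ->
  simplex (fun a => (1 - t) * w a + t * v a).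
Proof.
move=> [w0 w1] [v0 v1] /andP[t0 t1]; split.
  by move=> a; rewrite addr_ge0// mulr_ge0// subr_ge0.
by rewrite big_split/= -!mulr_sumr w1 v1 !mulr1 subrK.
Qed.

Lemma simplex_vertex (a : A) : simplex (fun b => (b == a)%:R : R).
Proof.
split=> [b|]; first by rewrite ler0n.
by rewrite (bigD1 a)//= eqxx big1 ?addr0// => b /negbTE ->.
Qed.

(** The simplex is a closed subset of the cube [[0, 1]^A], which is compact by Tychonoff's
    theorem. *)
Lemma simplex_compact :
  compact (simplex (A := A) : set (prod_topology (fun _ : A => R))).
Proof.
pose I := [set f : prod_topology (fun _ : A => R) | forall a, `[0, 1]%classic (f a : R)].
pose S := [set f : prod_topology (fun _ : A => R) | \sum_a f a = 1].
rewrite (_ : simplex (A := A) = I `&` S).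
  apply: compact_closedI.
    apply: (@tychonoff A (fun=> R) (fun=> `[0, 1]%classic)) => a.
    exact: segment_compact.
  apply: (@preimage_closed (prod_topology (fun _ : A => R)) R
    (fun f => \sum_a f a) [set 1]); last exact: closed_eq.
  move=> f _; apply: (@cvg_sumr R A _ (nbhs f) (fun a g => g a) f (nbhs_filter f)) => a.
  exact: (@proj_continuous A (fun=> R) a f).
apply/seteqP; split=> f.
  move=> [f0 f1]; split=> // a; rewrite /= in_itv/= f0/=.
  by rewrite -f1 (bigD1 a)//= lerDl sumr_ge0.
by move=> [f01 f1]; split=> // a; have := f01 a; rewrite /= in_itv => /andP[].
Qed.

Lemma wsq_ge0 w x : simplex w -> 0 <= wsq w x.
Proof. by move=> [w0 _]; apply: sumr_ge0 => a _; rewrite mulr_ge0// sqr_ge0. Qed.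

Lemma wsq_continuous w : continuous (wsq w).
Proof.
move=> x; apply: cvg_sumr => a; apply: cvgM; first exact: cvg_cst.
have dx : mdist (val a) y @[y --> x] --> mdist (val a) x.
  exact: mdist_continuous.
exact: (cvgM dx dx).
Qed.

Lemma wsq_segment w v t x :
  wsq (fun a => (1 - t) * w a + t * v a) x =
  (1 - t) * wsq w x + t * wsq v x.
Proof.
rewrite /wsq !mulr_sumr -big_split/=; apply: eq_bigr => a _.
by rewrite mulrDl !mulrA.
Qed.

Lemma wsq_vertex (a : A) x :
  wsq (fun b => (b == a)%:R) x = mdist (val a) x ^+ 2.
Proof.
rewrite /wsq (bigD1 a)//= eqxx mul1r big1 ?addr0// => b /negbTE ->.
by rewrite mul0r.
Qed.

Context (hX : hadamard_space X).

(** As the weights sum to 1, averaging the midpoint inequality over [A] leaves the term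
    [mdist x y ^+ 2 / 4] intact. *)
Lemma wsq_midpoint w x y : simplex w ->
  exists m, wsq w m <= (wsq w x + wsq w y) / 2 - mdist x y ^+ 2 / 4.
Proof.
have [cX geoX catX] := hX.
move=> [w0 w1]; have [m mP] := cat0_midpoint x y catX geoX; exists m.
rewrite [leRHS](_ : _ = \sum_a w a * ((mdist (val a) x ^+ 2 +
    mdist (val a) y ^+ 2) / 2 - mdist x y ^+ 2 / 4)).
  by apply: ler_sum => a _; apply: ler_wpM2l.
under [RHS]eq_bigr do rewrite mulrBr mulrA mulrDr.
by rewrite sumrB -!mulr_suml w1 mul1r big_split.
Qed.

Lemma minimizer_exists w : simplex w -> exists x, minimizes w x.
Proof.
have [cX _ _] := hX; move=> sw.
(* An empty sum of weights would be 0 instead of 1; the point [a] shows that [X] is inhabited. *)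
have [a _] : exists a : A, True.
  apply: contrapT => nA; have := sw.2; rewrite big1; last first.
    by move=> a _; exfalso; apply: nA; exists a.
  by move/esym/eqP; rewrite oner_eq0.
apply: (strongly_convex_minimizer (val a) cX (@wsq_continuous w)).
  by move=> x; exact: wsq_ge0.
by move=> x y; exact: wsq_midpoint.
Qed.

Lemma minimizer_growth w x y : simplex w -> minimizes w x ->
  wsq w x + mdist x y ^+ 2 / 2 <= wsq w y.
Proof.
by move=> sw mx; have [m] := wsq_midpoint x y sw; have := mx m; lra.
Qed.

Lemma minimizer_unique w x y : simplex w -> minimizes w x ->
  wsq w y <= wsq w x -> x = y.
Proof.
move=> sw mx yx; have := minimizer_growth y sw mx => h.
apply: mdist_positivity; apply/eqP; rewrite -sqrf_eq0 eq_le sqr_ge0 andbT.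
lra.
Qed.

(** Adding the growth inequalities of [w] at [x] and of [v] at [y] bounds [mdist x y ^+ 2] by the
    sum of [(w a - v a) * (mdist a y ^+ 2 - mdist a x ^+ 2)]. Each difference of squares has a
    factor at most [mdist x y], which is divided out. *)
Lemma minimizer_stability w v x y :
  simplex w -> minimizes w x -> simplex v -> minimizes v y ->
  mdist x y <= \sum_a `|w a - v a| * (mdist (val a) x + mdist (val a) y).
Proof.
move=> sw mx sv my.
have [->|d0] := eqVneq (mdist x y) 0.
  by apply: sumr_ge0 => a _; rewrite mulr_ge0// addr_ge0// mdist_ge0.
have d_gt0 : 0 < mdist x y by rewrite lt_neqAle eq_sym d0 mdist_ge0.
have hw := minimizer_growth y sw mx; have hv := minimizer_growth x sv my.
rewrite (metric_sym y x) in hv.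
have d2 : mdist x y ^+ 2 <= (wsq w y - wsq v y) - (wsq w x - wsq v x) by lra.
rewrite -(ler_pM2r d_gt0) -expr2 (le_trans d2)//.
rewrite /wsq -!sumrB mulr_suml; apply: ler_sum => a _.
rewrite -!mulrBl -mulrBr subr_sqr -mulrA (le_trans (ler_norm _))// !normrM.
rewrite ler_wpM2l// mulrC ler_pM//.
  by rewrite ger0_norm ?addr_ge0 ?mdist_ge0// addrC.
by rewrite distrC ler_dist_mdist.
Qed.

End WeightedMeans.

(** * Inclusions between the minimality notions; topology of the mean set *)

Section MeanSet.
Context {R : realType} {X : metricType R} {A : {fset X}}.
Implicit Types (w v : A -> R) (x y p : X) (t : R).
Context (hX : hadamard_space X) (hA : A <> fset0%fset).

(** If [y] is a competitor of [x], their midpoint is strictly closer to every point of [A], by the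
    term [mdist x y ^+ 2 / 4]. *)
Lemma minimal_sub_strongly : minimal_set A `<=` strongly_minimal_set A.
Proof.
have [_ geoX catX] := hX.
move=> x minx [y yx yle]; apply: minx.
have [m mP] := cat0_midpoint x y catX geoX; exists m => a aA.
rewrite -(ltr_pXn2r (n := 2)) ?nnegrE ?mdist_ge0//.
have d0 : 0 < mdist x y ^+ 2.
  by rewrite exprn_gt0// mdist_gt0; apply/eqP => /esym.
have := mP a; have : mdist a y ^+ 2 <= mdist a x ^+ 2.
  by rewrite ler_pXn2r ?nnegrE ?mdist_ge0 ?yle.
lra.
Qed.

Lemma strongly_sub_pareto : strongly_minimal_set A `<=` pareto_set A.
Proof.
move=> x sx y yle a aA; have [->//|yx] := pselect (y = x).
by exfalso; apply: sx; exists y.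
Qed.

Lemma pareto_sub_minimal : pareto_set A `<=` minimal_set A.
Proof.
have [a aA] : exists a, a \in A by apply/fset0Pn/eqP.
move=> x px [y ylt]; have := ylt a aA.
by rewrite (px y) ?ltxx// => b bA; exact/ltW/ylt.
Qed.

(** A competitor of a minimizer has no larger weighted sum, hence equals it by uniqueness. *)
Lemma mean_sub_strongly : mean_set A `<=` strongly_minimal_set A.
Proof.
move=> x [w sw mx] [y yx yle]; apply: yx; apply/esym.
apply: (minimizer_unique hX sw mx); apply: ler_sum => a _.
rewrite ler_wpM2l//; first by have [w0 _] := sw.
by rewrite ler_pXn2r ?nnegrE ?mdist_ge0// yle// (valP a).
Qed.

Lemma minimizer_bounded : exists2 K, 0 <= K &
  forall w x, simplex w -> minimizes w x ->
    forall a : A, mdist (val a) x <= K.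
Proof.
have [a0 a0A] : exists a, a \in A by apply/fset0Pn/eqP.
pose S : R := \sum_(a : A) mdist (val a) a0.
have S_ge (a : A) : mdist (val a) a0 <= S.
  by rewrite /S (bigD1 a)//= lerDl sumr_ge0// => b _; exact: mdist_ge0.
exists (S + S + S).
  by rewrite !addr_ge0// sumr_ge0// => b _; exact: mdist_ge0.
move=> w x sw mx a.
have /mean_sub_strongly/strongly_sub_pareto/pareto_sub_minimal xmin :
  mean_set A x by exists w.
(* By minimality of [x], the point [a0] cannot be strictly closer than [x] to all of [A]. The path
   from [a] to [x] through [a0] and [b] then has three legs, each at most [S]. *)
have [b bA bx] : exists2 b, b \in A & mdist b x <= mdist b a0.
  apply: contrapT => nb; apply: xmin; exists a0 => b bA.
  by rewrite ltNge; apply/negP => bx; apply: nb; exists b.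
have := metric_triangle (val a) a0 x; have := metric_triangle a0 b x.
rewrite (metric_sym a0 b) -[b in mdist b a0]/(val [` bA]%fset).
have := S_ge a; have /= := S_ge [` bA]%fset; lra.
Qed.

Lemma minimizer_lipschitz : exists2 K, 0 <= K & forall w v x y,
  simplex w -> minimizes w x -> simplex v -> minimizes v y ->
  mdist x y <= K * \sum_a `|w a - v a|.
Proof.
have [K K0 Kb] := minimizer_bounded; exists (K + K); first exact: addr_ge0.
move=> w v x y sw mx sv my.
apply: le_trans (minimizer_stability hX sw mx sv my) _.
rewrite mulr_sumr; apply: ler_sum => a _.
by rewrite mulrC ler_wpM2r// lerD// (Kb _ _ sw mx, Kb _ _ sv my).
Qed.

(** The parameter space is left general to cover both the whole simplex, for compactness, and a
    segment of weights over [[0, 1]], for paths. *)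
Lemma minimizer_continuous (Y : topologicalType) (D : set Y)
    (h : Y -> A -> R) (m : Y -> X) :
  (forall a, continuous (h^~ a)) ->
  (forall z, D z -> simplex (h z) /\ minimizes (h z) (m z)) ->
  {within D, continuous m}.
Proof.
move=> hcont hm; have [K K0 Klip] := minimizer_lipschitz.
apply/subspace_continuousP => /= z0 Dy.
apply/metricType_numDomainType.cvgrPdist_lt => e e0.
have [sy my] := hm z0 Dy.
pose phi z := K * \sum_a `|h z0 a - h z a|.
have phi_cvg : phi z @[z --> z0] --> phi z0.
  apply: cvgM; first exact: cvg_cst.
  apply: (@cvg_sumr R A Y (nbhs z0) _ _ (nbhs_filter z0)) => a.
  by apply: cvg_norm; apply: cvgB; [exact: cvg_cst|exact: hcont].
have phiy : phi z0 = 0.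
  by rewrite /phi big1 ?mulr0// => a _; rewrite subrr normr0.
have : \forall z \near z0, phi z < e.
  by apply: (cvgr_lt (phi z0)) => //; rewrite phiy.
apply: filterS => z phiz Dz; have [sz mz] := hm z Dz.
exact: le_lt_trans (Klip _ _ _ _ sy my sz mz) phiz.
Qed.

Lemma minimizer_function : exists m : (A -> R) -> X,
  forall w, simplex w -> minimizes w (m w).
Proof.
have [a0 a0A] : exists a, a \in A by apply/fset0Pn/eqP.
have /choice[m mP] w : exists x, simplex w -> minimizes w x.
  (* Outside the simplex the value [a0] is an arbitrary default. *)
  have [sw|nsw] := pselect (simplex w); last by exists a0.
  by have [x mx] := minimizer_exists hX sw; exists x.
by exists m.
Qed.

Lemma mean_setE (m : (A -> R) -> X) :
  (forall w, simplex w -> minimizes w (m w)) ->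
  mean_set A = m @` simplex (A := A).
Proof.
move=> mP; apply/seteqP; split=> [x [w sw mx]|_ [w sw <-]]; exists w => //.
  exact: (minimizer_unique hX sw (mP w sw) (mx _)).
exact: mP.
Qed.

Lemma mean_nonempty : mean_set A !=set0.
Proof.
have [a0 a0A] : exists a, a \in A by apply/fset0Pn/eqP.
have [m mP] := minimizer_function; rewrite (mean_setE mP).
pose w : A -> R := fun b => (b == [` a0A]%fset)%:R.
by exists (m w), w => //; exact: simplex_vertex.
Qed.

Let T := prod_topology (fun _ : A => R).

Let minimizer_within (m : (A -> R) -> X) :
  (forall w, simplex w -> minimizes w (m w)) ->
  {within simplex (A := A) : set T, continuous (m : T -> X)}.
Proof.
move=> mP; apply: (@minimizer_continuous T _ (fun f => f)).
  by move=> a f; exact: (@proj_continuous A (fun=> R) a f).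
by move=> f sf; split=> //; exact: mP.
Qed.

Lemma mean_compact : compact (mean_set A).
Proof.
have [m mP] := minimizer_function; rewrite (mean_setE mP).
apply: (@continuous_compact T X m); last exact: simplex_compact.
exact: minimizer_within.
Qed.

Lemma mean_path_connected : path_connected (mean_set A).
Proof.
have [m mP] := minimizer_function.
move=> x y [w sw mx] [v sv my].
pose h t (a : A) : R := (1 - t) * w a + t * v a.
have sh t : `[0, 1]%classic t -> simplex (h t).
  by rewrite /= in_itv/= => t01; exact: simplex_segment.
have h0 : h 0 = w by apply/funext => a; rewrite /h subr0 mul1r mul0r addr0.
have h1 : h 1 = v by apply/funext => a; rewrite /h subrr mul1r mul0r add0r.
exists (m \o h); split.
- apply: (minimizer_continuous (h := h)).
    move=> a t; apply: cvgD; apply: cvgM; try exact: cvg_cst; last exact: cvg_id.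
    by apply: cvgB; [exact: cvg_cst|exact: cvg_id].
  by move=> t /sh st; split=> //; exact: mP.
- by rewrite /= h0; apply: (minimizer_unique hX sw (mP w sw)); exact: mx.
- by rewrite /= h1; apply: (minimizer_unique hX sv (mP v sv)); exact: my.
- by move=> _ [t /sh st <-]; exists (h t) => //; exact: mP.
Qed.

(* Let w maximise the dual function q(w) = min_x (wsq w x - wsq w xbar) and let
   x be the minimizer of wsq w. Moving w towards the vertex a of the simplex
   cannot increase q, whence d(a, x)^2 - d(a, xbar)^2 <= q(w) <= 0 for all a. *)
Lemma strongly_sub_mean : strongly_minimal_set A `<=` mean_set A.
Proof.
move=> xbar sxbar; have [m mP] := minimizer_function.
pose q (w : T) := wsq w (m w) - wsq w xbar.
have cq : {within simplex (A := A) : set T, continuous q}.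
  apply/subspace_continuousP => w sw.
  have /subspace_continuousP/(_ w sw) mw := minimizer_within mP.
  have wa (a : A) : f a @[f --> within (simplex (A := A)) (nbhs w)] --> w a.
    apply: (cvg_trans _ (@proj_continuous A (fun=> R) a w)).
    exact: (cvg_app _ (cvg_within _)).
  have dm (a : A) : mdist (val a) (m f)
      @[f --> within (simplex (A := A)) (nbhs w)] --> mdist (val a) (m w).
    exact: (cvg_comp _ _ mw (@mdist_continuous R X (val a) (m w))).
  by apply: cvgB; apply: cvg_sumr => a; apply: cvgM => //;
    [exact: (cvgM (dm a) (dm a))|exact: cvg_cst].
have [a0 a0A] : exists a, a \in A by apply/fset0Pn/eqP.
have s0 : (simplex (A := A) : set T) !=set0.
  by eexists; exact: (simplex_vertex [` a0A]%fset).
have [w /set_mem sw wmax] := compact_EVT_max s0 simplex_compact cq.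
have q_le0 : q w <= 0 by rewrite subr_le0; exact: mP.
have [K K0 Klip] := minimizer_lipschitz.
suff mw_le (a : A) : mdist (val a) (m w) <= mdist (val a) xbar.
  have <- : m w = xbar.
    apply: contrapT => mx; apply: sxbar; exists (m w) => // a aA.
    exact: (mw_le [` aA]%fset).
  by exists w => //; exact: mP.
pose e : A -> R := fun b => (b == a)%:R.
have se : simplex e by exact: simplex_vertex.
pose wt t : A -> R := fun b => (1 - t) * w b + t * e b.
have swt t : 0 < t <= 1 -> simplex (wt t).
  by move=> /andP[t0 t1]; apply: simplex_segment; rewrite // ltW.
(* As [m w] minimizes [wsq w], [q (wt t)] is at least [(1 - t) * q w + t * (d - d')]; as it is at
   most [q w], dividing by [t] gives [d - d' <= q w]. *)
have wt_le t : 0 < t <= 1 -> mdist (val a) (m (wt t)) <= mdist (val a) xbar.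
  move=> t01; have /andP[t0 t1] := t01.
  rewrite -(ler_pXn2r (n := 2)) ?nnegrE ?mdist_ge0//.
  have := wmax (wt t) (mem_set (swt t t01)).
  rewrite /q !wsq_segment !wsq_vertex.
  have := mP w sw (m (wt t)).
  move: q_le0; rewrite /q.
  set d := mdist _ (m _) ^+ 2; set d' := mdist _ xbar ^+ 2.
  nra.
pose L := K * \sum_b `|w b - e b|.
have L0 : 0 <= L by rewrite mulr_ge0// sumr_ge0.
(* The bound at [m (wt t)] passes to [m w] as [t] tends to 0: the two points are at most [t * L]
   apart, and the chosen [t] makes this at most [r]. *)
apply/ler_addgt0Pr => r r0.
pose t := r / (L + 1 + r).
have D0 : 0 < L + 1 + r by lra.
have tD : t * (L + 1 + r) = r by rewrite /t divfK// gt_eqF.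
have t01 : 0 < t <= 1.
  by rewrite divr_gt0//= /t ler_pdivrMr// mul1r; lra.
have tr : t * L <= r by have /andP[] := t01; nra.
have := Klip _ _ _ _ sw (mP w sw) (swt t t01) (mP _ (swt t t01)).
rewrite [leRHS](_ : _ = t * L); last first.
  rewrite /L mulrCA; congr (K * _); rewrite mulr_sumr; apply: eq_bigr => b _.
  have /andP[/ltW t0 _] := t01.
  rewrite -[in RHS](ger0_norm t0) -normrM; congr `|_|; rewrite /wt; ring.
have := metric_triangle (val a) (m (wt t)) (m w).
rewrite (metric_sym (m (wt t))); have := wt_le t t01; lra.
Qed.

End MeanSet.

(** * Minimal points and the closed convex hull *)

Section ConvexHull.
Context {R : realType} {X : metricType R}.

Lemma conv_hull_gconvex (B : set X) : gconvex (conv_hull B).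
Proof.
move=> x y S Cx Cy gS z Sz C CB; have [cvxC _] := CB.
exact: (cvxC x y S (Cx _ CB) (Cy _ CB) gS z Sz).
Qed.

(* A point c of the hull almost nearest to x is strictly closer to every point
   of A than x is: compare x with points of the segment [c, a] close to c. *)
Lemma minimal_sub_closure_hull (A : {fset X}) :
  hadamard_space X -> A <> fset0%fset ->
  minimal_set A `<=` closure (conv_hull [set` A]).
Proof.
move=> [_ geoX catX] hA x minx; set C := conv_hull [set` A].
have AC : [set` A] `<=` C by exact: sub_gen_smallest.
have [a0 a0A] : exists a, a \in A by apply/fset0Pn/eqP.
apply: contrapT => nCx.
have [e e0 xe] : exists2 e : R, 0 < e & forall c, C c -> e <= mdist x c.
  apply: contrapT => nfar; apply: nCx => U /nbhs_ballP[e /= e0 eU].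
  apply: contrapT => UC; apply: nfar; exists e => // c Cc.
  rewrite leNgt; apply/negP => xc; apply: UC; exists c; split=> //.
  by apply: eU; rewrite ballEmdist.
pose Q := [set mdist x c ^+ 2 | c in C].
have hinf : has_inf Q.
  split; first by exists (mdist x a0 ^+ 2), a0 => //; exact: AC.
  by exists 0 => _ [c _ <-]; exact: sqr_ge0.
pose E := inf Q.
have E_le c : C c -> E <= mdist x c ^+ 2.
  by move=> Cc; apply: (ge_inf (proj2 hinf)); exists c.
have E0 : 0 < E.
  apply: lt_le_trans (exprn_gt0 2 e0) _.
  apply: lb_le_inf; first by case: hinf.
  by move=> _ [c Cc <-]; rewrite ler_pXn2r ?nnegrE ?mdist_ge0 ?(ltW e0)// xe.
pose S : R := \sum_(a : A) mdist x (val a) ^+ 2.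
have S_ge a : a \in A -> mdist x a ^+ 2 <= S.
  move=> aA; rewrite /S (bigD1 [` aA]%fset)//= lerDl.
  by rewrite sumr_ge0// => b _; exact: sqr_ge0.
have S0 : 0 <= S by rewrite sumr_ge0// => b _; exact: sqr_ge0.
(* This [t] is small enough that [t * r <= E / 4] once [r], the squared distance from [c] to [a], is
   bounded by [2 * S]. *)
pose t := E / (8 * S + 4 * E).
have D0 : 0 < 8 * S + 4 * E by lra.
have tD : t * (8 * S + 4 * E) = E by rewrite /t divfK// gt_eqF.
have t0 : 0 < t by rewrite divr_gt0.
have t1 : t <= 4^-1 by rewrite /t ler_pdivrMr//; lra.
have n0 : 0 < t * E / 4 by rewrite divr_gt0// mulr_gt0.
have [_ [c Cc <-]] := inf_adherent n0 hinf; rewrite -/E => xc.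
apply: minx; exists c => a aA.
have [g gg] := geoX c a.
(* The segment from [c] to [a] stays in the hull, so its points are at squared distance at least [E]
   from [x]. *)
have E_cmp s : 0 <= s <= 1 -> E <= (1 - s) * mdist x c ^+ 2
    + s * mdist x a ^+ 2 - s * (1 - s) * mdist c a ^+ 2.
  move=> s01; apply: le_trans (cat0_comparison x catX geoX gg s01).
  apply: E_le; apply: (conv_hull_gconvex Cc (AC _ aA)).
    by exists g; [exact: gg|reflexivity].
  exists (s * mdist c a) => //; rewrite /= in_itv/=.
  have /andP[s0 s1] := s01.
  by rewrite mulr_ge0 ?mdist_ge0//= ler_piMl ?mdist_ge0.
rewrite (metric_sym a c) (metric_sym a x).
rewrite -(ltr_pXn2r (n := 2)) ?nnegrE ?mdist_ge0//.
have := S_ge a aA.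
(* The midpoint yields the bound [r <= 2 * S]; the parameter [t] then yields the strict
   inequality. *)
have := E_cmp (2^-1) ltac:(apply/andP; split; lra).
have := E_cmp t ltac:(apply/andP; split; lra).
have : 0 <= mdist c a ^+ 2 by exact: sqr_ge0.
move: xc.
set b := mdist x c ^+ 2; set s := mdist x a ^+ 2; set r := mdist c a ^+ 2.
move=> bE r0 Et Eh sS.
have rS : r <= 2 * S by nra.
have tr : t * r <= E / 4 by nra.
have tb : (1 - t) * b <= E + t * E / 4 - t * E by nra.
suff : t * r < t * s by rewrite ltr_pM2l.
have : t * (t * r) <= t * (E / 4) by rewrite ler_pM2l.
have : 0 < t * E by rewrite mulr_gt0.
lra.
Qed.

End ConvexHull.

Theorem corollary6p5 (R : realType) (X : metricType R) (A : {fset X})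
    (hX : hadamard_space X) (hA : A <> fset0%fset) :
  [/\ mean_set A !=set0, compact (mean_set A), path_connected (mean_set A)
    & mean_set A `<=` closure (conv_hull [set` A])] /\
  [/\ mean_set A = strongly_minimal_set A, mean_set A = pareto_set A, mean_set A = minimal_set A
    & minimal_set A `<=` closure (conv_hull [set` A])].
Proof.
(* The inclusions close a cycle: mean, strongly minimal, Pareto, minimal, strongly minimal, mean. *)
have mean_strongly := mean_sub_strongly (A := A) hX.
have strongly_mean := strongly_sub_mean hX hA.
have strongly_pareto := strongly_sub_pareto (A := A).
have pareto_minimal := pareto_sub_minimal hA.
have minimal_strongly := minimal_sub_strongly (A := A) hX.
have minimal_hull := minimal_sub_closure_hull hX hA.
split; split=> //.
- exact: mean_nonempty.
- exact: mean_compact.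
- exact: mean_path_connected.
- by move=> x /mean_strongly/strongly_pareto/pareto_minimal/minimal_hull.
- by apply/seteqP; split.
- apply/seteqP; split=> x; first by move=> /mean_strongly/strongly_pareto.
  by move=> /pareto_minimal/minimal_strongly/strongly_mean.
- apply/seteqP; split=> x.
    by move=> /mean_strongly/strongly_pareto/pareto_minimal.
  by move=> /minimal_strongly/strongly_mean.
Qed.
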